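(* Let $c\in\mathbb{N}=\{0,1,2,\dots\}$ and $k=2j$, where $j$ is a positive integer. Then for $j\geq 3$ we have, as $a\to\infty$ through the nonnegative integers, $$\left([q^{aj-c}]-[q^{aj-c-1}]\right)\binom{a+k}{k}_q=\frac{2c+1}{(k-3)!\,k!}\,D(k)\,a^{k-3}+O(a^{k-4}),$$ where $$D(k)=\frac12\sum_{i=0}^{j-1}(-1)^{i+1}\binom{k}{i}(j-i)^{k-3}.$$
   Context: Here $\binom{a+k}{k}_q=\frac{(1-q^{a+1})(1-q^{a+2})\cdots(1-q^{a+k})}{(1-q)(1-q^2)\cdots(1-q^k)}$ is the $q$-binomial coefficient, a polynomial in $q$; $[q^n]F(q)$ denotes the coefficient of $q^n$ in $F(q)$ (equal to $0$ if $n<0$), and $([q^{n}]-[q^{n-1}])F(q)$ means $[q^n]F(q)-[q^{n-1}]F(q)$. The notation $f(a)=O(g(a))$ for $a\to\infty$ means $|f(a)|\leq C\cdot|g(a)|$ for some constant $C>0$ and all sufficiently large $a$; the constant may depend on $c$ and $k$. *)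

(* Defs.v *)
From mathcomp Require Import all_boot all_order all_algebra.
From mathcomp Require Import ring.

Set Implicit Arguments.
Unset Strict Implicit.
Unset Printing Implicit Defensive.

Import Order.TTheory GRing.Theory Num.Theory.
Local Open Scope ring_scope.

(* The q-binomial coefficient binom(a + k, k)_q, with 'X in the role of q.
   The Euclidean quotient is exact: see qbinomE. *)
Definition qbinom (F : fieldType) (a k : nat) : {poly F} :=
  (\prod_(1 <= i < k.+1) (1 - 'X^(a + i))) %/ (\prod_(1 <= i < k.+1) (1 - 'X^i)).

Lemma qbinom_dvd (F : fieldType) (a k : nat) :
  (\prod_(1 <= i < k.+1) (1 - 'X^i) : {poly F}) %|
  \prod_(1 <= i < k.+1) (1 - 'X^(a + i)).
Proof.
elim: k a => [|k IHk]; first by move=> a; rewrite !big_nil.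
elim=> [|a IHa]; first exact: dvdpp.
have splitr : \prod_(1 <= i < k.+2) (1 - 'X^(a.+1 + i)) =
    \prod_(1 <= i < k.+2) (1 - 'X^(a + i)) + 'X^(a.+1) *
    (\prod_(1 <= i < k.+1) (1 - 'X^(a.+1 + i)) * (1 - 'X^(k.+1))) :> {poly F}.
  rewrite big_nat_recr //= [X in _ = X + _]big_nat_recl //=.
  under [X in _ = _ * X + _]eq_bigr do rewrite -addSnnS.
  rewrite addn1 [in LHS]exprD; ring.
rewrite splitr dvdp_add //; apply: dvdp_mull.
by rewrite big_nat_recr //=; apply: dvdp_mul.
Qed.

Lemma qbinomE (F : fieldType) (a k : nat) :
  qbinom F a k * (\prod_(1 <= i < k.+1) (1 - 'X^i)) =
  \prod_(1 <= i < k.+1) (1 - 'X^(a + i)).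
Proof. exact/divpK/qbinom_dvd. Qed.

(* [q^n] p for an integer exponent n. *)
Definition coefz (R : nzRingType) (n : int) (p : {poly R}) : R :=
  if n is Posz m then p`_m else 0.

(* D(k), with j = k/2. *)
Definition Dk (R : fieldType) (k : nat) : R :=
  2%:R^-1 * \sum_(0 <= i < k./2)
    (-1) ^+ i.+1 * ('C(k, i))%:R * (k./2 - i)%:R ^+ (k - 3).

(* Main.v *)
Require Import Defs.
From mathcomp Require Import all_boot all_order all_algebra.
From mathcomp Require Import ring zify.
From mathcomp Require Import classical_sets functions reals topology normedtype landau.

Import Order.TTheory GRing.Theory Num.Theory.
Import numFieldNormedType.Exports.
Local Open Scope classical_set_scope.
Local Open Scope ring_scope.

(** Write [i] for 1 + q + ... + q^(i-1), Q for [2][3]...[k], and N for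
    (1 - q^(a+1))...(1 - q^(a+k)).  The difference of consecutive coefficients
    of the q-binomial is a coefficient of G = (1 - q) binom(a+k, k)_q, and
    (1 - q)^(k-1) Q G = N ([oneBX_qbinom]).  So G = N / ((1 - q)^(k-1) Q), and
    the growth of its coefficients is governed by the pole at q = 1, provided
    that the poles at the other roots of unity have smaller order.

    Expanding 1/Q at q = 1 to two terms ([qfact_inverse]),
      1 = Q (u0 + u1 (1 - q)) + (1 - q)^2 h,
      u0 = 1/k!,  u1 = k(k-1)/(4 k!),
    splits G as
      u0 N/(1-q)^(k-1) + u1 N/(1-q)^(k-2) + h N/((1-q)^(k-3) Q).

    The last term is an error term.  Every root of (1-q)^(k-3) Q has order at
    most k - 3: this is where j >= 3 enters, -1 being a root of order j = k/2.
    Concretely, consecutive q-integers are coprime, so grouping the factors of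
    Q as {2,3}, {4,5}, {6}, ..., {k} shows that (1-q)^(k-3) Q divides
    (1 - q^L)^(k-3) for L = k! ([qfact_dvd]).  A quotient by (1 - q^L)^(d+1) of
    a polynomial with absolute coefficient sum at most K has n-th coefficient
    at most K (n+1)^d in absolute value ([coef_div_oneBXn_exp]); here d = k - 4
    and K does not depend on a, since the numerator is N times a fixed
    polynomial ([qbinom_remainder_bound]).

    The two main terms are explicit.  Expanding N over subsets S of {1..k} and
    writing s(S) for the sum of S, the coefficient of q^(aj-c) in N/(1-q)^(d+1)
    is the sum of (-1)^|S| binom(a(j-|S|) - c - s(S) + d, d), and for large a
    precisely the S with |S| < j contribute.  So the main part is a polynomial
    in a of degree at most k - 2 ([main_poly_spec]), and two of its
    coefficients are needed.  With r = j - i and i = |S|: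
    - the coefficient of a^(k-2) is a multiple of the sum over i < j of
      (-1)^i binom(k,i) r^(k-2).  The exponent is even, so this is half of the
      sum over all i <= k, a k-th finite difference of a polynomial of degree
      less than k, which vanishes ([half_alternating_binomial_sum]);
    - in the coefficient of a^(k-3), s(S) may be replaced by its mean
      i(k+1)/2 over the sets of size i ([set_sum_by_card]).  The summand
      becomes (-1)^i binom(k,i) r^(k-3) (-(2c+1)/2 + r(k+1)/2) up to the factor
      1/(k!(k-3)!); the second part vanishes for the same reason, and the first
      gives (2c+1) D(k). *)

Set Implicit Arguments.
Unset Strict Implicit.

(** * Alternating binomial sums and sums over subsets *)

(** The k-th finite difference kills polynomials of degree less than k.  Split
    one factor as x + i: the x part has lower degree, and i binom(n, i) =
    n binom(n-1, i-1) turns the other into the same sum for n - 1. *)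
Lemma alternating_binomial_power_sum (R : comNzRingType) (m n : nat) (x : R) :
  (m < n)%N ->
  \sum_(i < n.+1) (-1) ^+ i * 'C(n, i)%:R * (x + i%:R) ^+ m = 0.
Proof.
elim: m n x => [|m IHm] [|n] x //= ltmn.
  transitivity ((1 - 1 : R) ^+ n.+1); last by rewrite subrr expr0n.
  by rewrite exprBn; apply: eq_bigr => i _; rewrite !expr1n !mulr1 mulr_natr.
have shift (i : 'I_n.+2) : (-1) ^+ i * 'C(n.+1, i)%:R * (x + i%:R) ^+ m.+1 =
    x * ((-1) ^+ i * 'C(n.+1, i)%:R * (x + i%:R) ^+ m) +
    (-1) ^+ i * (i * 'C(n.+1, i))%N%:R * (x + i%:R) ^+ m.
  by rewrite exprS natrM; ring.
under eq_bigr do rewrite shift.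
rewrite big_split /= -mulr_sumr IHm ?mulr0 ?add0r; last by lia.
rewrite big_ord_recl mul0n mulr0 mul0r add0r.
under eq_bigr => i _.
  rewrite lift0 -mul_bin_diag natrM exprS.
  have -> : x + i.+1%:R = (x + 1) + i%:R by rewrite -natr1; ring.
  rewrite (_ : _ * _ * _ = - n.+1%:R * ((-1) ^+ i * 'C(n, i)%:R * (x + 1 + i%:R) ^+ m)).
    over.
  by ring.
by rewrite -mulr_sumr IHm ?mulr0.
Qed.

(** The summand is invariant under i -> 2j - i because the exponent is even, and
    it vanishes at i = j; so this is half of a sum over all i <= 2j. *)
Lemma half_alternating_binomial_sum (R : numDomainType) (j : nat) :
  (2 <= j)%N ->
  \sum_(i < j) (-1) ^+ i * 'C(2 * j, i)%:R * (j - i)%:R ^+ (2 * j - 2) = 0 :> R.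
Proof.
move=> le2j; pose f i : R := (-1) ^+ i * 'C(2 * j, i)%:R * (- j%:R + i%:R) ^+ (2 * j - 2).
have sym i : (i <= 2 * j)%N -> f (2 * j - i)%N = f i.
  move=> le_i; rewrite /f bin_sub // natrB // natrM.
  congr (_ * _ * _).
    by rewrite -signr_odd -[RHS]signr_odd oddB // mul2n odd_double.
  have -> : - j%:R + (2%:R * j%:R - i%:R) = - (- j%:R + i%:R) :> R by ring.
  by rewrite exprNn -signr_odd oddB ?mul2n ?odd_double ?mul1r //=; lia.
have total : \sum_(0 <= i < (2 * j).+1) f i = 0.
  by rewrite big_mkord; apply: alternating_binomial_power_sum; lia.
have fj : f j = 0 by rewrite /f addNr expr0n; case: eqP; [lia | rewrite mulr0].
have half : \sum_(0 <= i < j) f i = \sum_(j.+1 <= i < (2 * j).+1) f i.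
  rewrite [RHS]big_nat_rev /= -[j.+1]add0n big_addn.
  rewrite (_ : (2 * j).+1 - j.+1 = j)%N; last by lia.
  rewrite big_nat_cond [RHS]big_nat_cond; apply: eq_bigr => i /andP[/andP[_ lt_ij] _].
  by rewrite -sym; [congr f; lia | lia].
move: total; rewrite (@big_cat_nat _ _ _ j) /=; [|lia..].
rewrite (@big_ltn _ _ _ j); last by lia.
rewrite fj add0r -half -mulr2n => /eqP; rewrite mulrn_eq0 /= => /eqP.
rewrite big_mkord => half0; rewrite -[RHS]half0; apply: eq_bigr => i _.
congr (_ * _); rewrite natrB; last by apply: ltnW.
rewrite -[j%:R - _]opprB exprNn -signr_odd oddB ?mul2n ?odd_double ?mul1r 1?addrC //; lia.
Qed.

Lemma big_sets_by_card (R : nmodType) (k j : nat) (F : {set 'I_k} -> R) :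
  \sum_(S : {set 'I_k} | (#|S| < j)%N) F S =
  \sum_(i < j) \sum_(S : {set 'I_k} | #|S| == i) F S.
Proof.
rewrite (exchange_big_dep (fun S : {set 'I_k} => #|S| < j)%N) /=; last first.
  by move=> i S _ /eqP->.
apply: eq_bigr => S ltSj; rewrite (big_pred1 (Ordinal ltSj)) //.
Qed.

Lemma card_sets_by_card (k i : nat) :
  \sum_(S : {set 'I_k} | #|S| == i) 1 = 'C(k, i).
Proof.
by rewrite sum1_card -[in RHS](card_ord k) -card_draws; apply: eq_card => S; rewrite !inE.
Qed.

(** The reflection x -> k + 1 - x permutes the sets of size i, and the sums of a
    set and of its reflection add up to i(k+1). *)
Lemma set_sum_by_card (k i : nat) :
  (2 * \sum_(S : {set 'I_k} | #|S| == i) \sum_(x in S) x.+1 = 'C(k, i) * (i * k.+1))%N.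
Proof.
rewrite mul2n -addnn.
rewrite [X in (X + _)%N](reindex_inj (imset_inj (@rev_ord_inj k))) /=.
rewrite [X in (X + _)%N](eq_bigl (fun S : {set 'I_k} => #|S| == i)); last first.
  by move=> S; rewrite card_imset //; apply: rev_ord_inj.
under eq_bigr => S _ do rewrite (big_imset _ (in2W (@rev_ord_inj k))) /=.
rewrite -big_split /= -card_sets_by_card big_distrl /=.
apply: eq_bigr => S /eqP <-; rewrite -big_split /= mul1n -sum_nat_const.
by apply: eq_bigr => x _ /=; have := ltn_ord x; lia.
Qed.

(** * The q-factorial: divisibility and expansion at 1 *)

Definition qint (R : nzRingType) (n : nat) : {poly R} := \sum_(i < n) 'X^i.

Definition qfact (R : nzRingType) (k : nat) : {poly R} :=
  \prod_(2 <= i < k.+1) qint R i.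

Lemma qfactS (R : nzRingType) (k : nat) :
  (1 <= k)%N -> qfact R k.+1 = qfact R k * qint R k.+1.
Proof. by move=> k_gt0; rewrite /qfact big_nat_recr. Qed.

Lemma mul_qint (R : comNzRingType) (n : nat) : (1 - 'X) * qint R n = 1 - 'X^n.
Proof. by apply: oppr_inj; rewrite -mulNr !opprB -subrX1. Qed.

Lemma mul_qfact (R : comNzRingType) (k : nat) : (1 <= k)%N ->
  (1 - 'X) ^+ k * qfact R k = \prod_(1 <= i < k.+1) (1 - 'X^i).
Proof.
case: k => // k _; elim: k => [|k IHk].
  by rewrite /qfact big_geq // mulr1 big_nat1.
rewrite qfactS // [RHS]big_nat_recr //= -IHk -mul_qint exprSr; ring.
Qed.

Lemma oneBX_neq0 (R : nzRingType) : 1 - 'X != 0 :> {poly R}.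
Proof. by rewrite -oppr_eq0 opprB -size_poly_eq0 -[1]/(1%:P) size_XsubC. Qed.

Lemma qint_dvd (F : fieldType) (m n : nat) : (m %| n)%N -> qint F m %| qint F n.
Proof.
case/dvdnP=> t ->; suff -> : qint F (t * m) = (\sum_(i < t) ('X^m) ^+ i) * qint F m.
  exact: dvdp_mull.
apply: (mulfI (oneBX_neq0 F)); rewrite mulrCA !mul_qint.
rewrite mulnC exprM; apply: oppr_inj; rewrite opprB subrX1; ring.
Qed.

(** [n+1] - q [n] = 1 is a Bezout relation. *)
Lemma qint_coprime_succ (F : fieldType) (n : nat) : coprimep (qint F n) (qint F n.+1).
Proof.
apply/Bezout_coprimepP; exists (- 'X, 1) => /=.
rewrite mul1r /qint big_ord_recl expr0 mulr_sumr -[X in X %= _]addrC.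
rewrite -addrA -big_split big1 /= ?addr0 ?eqpxx // => i _.
by rewrite exprS mulNr subrr.
Qed.

Lemma qint_pair_dvd (F : fieldType) (i L : nat) : (i %| L)%N -> (i.+1 %| L)%N ->
  (1 - 'X) * qint F i * qint F i.+1 %| 1 - 'X^L.
Proof.
move=> iL i1L; rewrite -mul_qint -mulrA dvdp_mul2l ?oneBX_neq0 //.
by rewrite Gauss_dvdp ?qint_coprime_succ // !qint_dvd.
Qed.

(** Q has k - 1 factors, but only k - 3 copies of 1 - q^L are needed: the pairs
    {2,3} and {4,5} are coprime and so fit into one copy each.  This saving of
    two is what makes the remainder of the two-term expansion negligible. *)
Lemma qfact_dvd (F : fieldType) (k L : nat) : (5 <= k)%N ->
  (forall i, (0 < i <= k)%N -> (i %| L)%N) ->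
  (1 - 'X) ^+ (k - 3) * qfact F k %| (1 - 'X^L) ^+ (k - 3).
Proof.
case: k => [|[|[|[|[|k]]]]] // _; rewrite subSS subSS subSS subn0.
elim: k => [|k IHk] dvdL.
  have := dvdp_mul (qint_pair_dvd F (dvdL 2 isT) (dvdL 3 isT))
                   (qint_pair_dvd F (dvdL 4 isT) (dvdL 5 isT)).
  rewrite -expr2 (_ : qfact F 5 = qint F 2 * qint F 3 * (qint F 4 * qint F 5)).
    move: (qint F 2) (qint F 3) (qint F 4) (qint F 5) => q2 q3 q4 q5.
    by rewrite (_ : (1 - 'X) ^+ 2 * (q2 * q3 * (q4 * q5)) =
      (1 - 'X) * q2 * q3 * ((1 - 'X) * q4 * q5)) //; ring.
  rewrite 4?qfactS // /qfact big_geq // mul1r.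
  by rewrite mulrA.
have IH := IHk (fun i lei => dvdL i ltac:(lia)).
rewrite qfactS // [(1 - 'X^L) ^+ _]exprSr [(1 - 'X) ^+ _]exprSr.
rewrite (_ : _ * _ = (1 - 'X) ^+ k.+2 * qfact F k.+2.+3 * ((1 - 'X) * qint F k.+3.+3)).
  by apply: dvdp_mul => //; rewrite -!mul_qint dvdp_mul // qint_dvd // dvdL //; lia.
ring.
Qed.

(** Taylor expansion at q = 1, where q^i = (1 - (1 - q))^i. *)
Lemma qint_expansion (R : comNzRingType) (n : nat) : exists h : {poly R},
  qint R n = n%:R - (\sum_(i < n) i)%:R * (1 - 'X) + (1 - 'X) ^+ 2 * h.
Proof.
have expX i : exists h : {poly R}, 'X^i = 1 - i%:R * (1 - 'X) + (1 - 'X) ^+ 2 * h.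
  elim: i => [|i [h IHi]]; first by exists 0; rewrite expr0; ring.
  by exists (i%:R + 'X * h); rewrite exprS IHi -natr1; ring.
elim: n => [|n [h IHn]].
  by exists 0; rewrite /qint !big_ord0; ring.
have [g Xn] := expX n; exists (h + g).
rewrite {1}/qint !big_ord_recr /= -/(qint R n) IHn Xn natrD -natr1; ring.
Qed.

(** The logarithmic derivative of [i] at q = 1 is (i - 1)/2, and these add up
    to k(k-1)/4. *)
Lemma qfact_expansion (F : numFieldType) (k : nat) : (1 <= k)%N ->
  exists h : {poly F},
  qfact F k = k`!%:R * (1 - ((k * k.-1)%:R / 4%:R)%:P * (1 - 'X)) + (1 - 'X) ^+ 2 * h.
Proof.
case: k => // k _; elim: k => [|k [h IHk]].
  by exists 0; rewrite /qfact big_geq //= muln0 !mul0r subr0 mulr0 addr0 mulr1.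
have [g qk] := qint_expansion F k.+2.
have sumk : (\sum_(i < k.+2) i)%:R = ((k.+2 * k.+1)%:R / 2%:R)%:P :> {poly F}.
  rewrite -polyC_natr; congr (_%:P); apply: (mulIf (_ : 2%:R != 0)); first by rewrite pnatr_eq0.
  rewrite mulfVK ?pnatr_eq0 // -natrM; congr (_%:R).
  elim: k {IHk h g qk} => [|k IHk]; first by rewrite !big_ord_recr big_ord0.
  by rewrite big_ord_recr /= mulnDl IHk; lia.
rewrite qfactS // IHk qk sumk [k.+2`!]factS [(k.+2 * _`!)%:R]natrM.
set u := ((k.+1 * _)%:R / _)%:P; set v := ((k.+2 * _)%:R / 2%:R)%:P.
have uv : ((k.+2 * k.+2.-1)%:R / 4%:R)%:P * k.+2%:R = u * k.+2%:R + v.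
  rewrite -polyC_natr -!polyCM -polyCD; congr (_%:P).
  rewrite /= !natrM -![k.+2%:R]natr1 -![k.+1%:R]natr1; field.
  by rewrite ?pnatr_eq0.
set w := (_)%:P in uv *.
exists (k.+1`!%:R * u * v + k.+1`!%:R * (1 - u * (1 - 'X)) * g + h * qint F k.+2).
have -> : k.+2%:R * k.+1`!%:R * (1 - w * (1 - 'X)) =
    k.+1`!%:R * k.+2%:R - k.+1`!%:R * (w * k.+2%:R) * (1 - 'X) by ring.
rewrite uv qk sumk -/v; ring.
Qed.

(** The reciprocal of k! (1 - u (1-q)) to second order is (1 + u (1-q)) / k!. *)
Lemma qfact_inverse (F : numFieldType) (k : nat) : (1 <= k)%N ->
  exists h : {poly F},
  qfact F k * ((k`!%:R^-1)%:P + ((k * k.-1)%:R / 4%:R / k`!%:R)%:P * (1 - 'X))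
    + (1 - 'X) ^+ 2 * h = 1.
Proof.
move=> /(qfact_expansion F)[h ->].
set u := (k * k.-1)%:R / 4%:R.
have k0 : k`!%:R != 0 :> F by rewrite pnatr_eq0 -lt0n fact_gt0.
have unit_k : k`!%:R * (k`!%:R^-1)%:P = 1 :> {poly F}.
  by rewrite -polyC_natr -polyCM mulfV.
rewrite (polyCM u k`!%:R^-1); move: (k`!%:R^-1)%:P unit_k => v unit_k.
exists (u%:P ^+ 2 - h * (v + u%:P * v * (1 - 'X))).
rewrite -[RHS]unit_k; set f := k`!%:R in unit_k *.
transitivity (f * v + (1 - 'X) ^+ 2 * u%:P ^+ 2 * (1 - f * v)); first by ring.
by rewrite unit_k; ring.
Qed.

(** * Coefficients of quotients by powers of 1 - X^L *)

(** Dividing by 1 - X^L sums the coefficients along a progression of step L, so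
    a coefficient of the quotient is at most the sum of the absolute values of
    the coefficients of the numerator up to the same index. *)
Lemma coef_div_oneBXn (R : numDomainType) (L : nat) (C : {poly R}) (n : nat) :
  (0 < L)%N -> `|C`_n| <= \sum_(m < n.+1) `|((1 - 'X^L) * C)`_m|.
Proof.
move=> L_gt0; elim/ltn_ind: n => n IHn.
have -> : C`_n = ((1 - 'X^L) * C)`_n + ('X^L * C)`_n.
  by rewrite mulrBl mul1r coefB subrK.
apply: (le_trans (ler_normD _ _)).
rewrite big_ord_recr /= [leRHS]addrC lerD2l coefXnM.
case: ltnP => [_|leLn]; first by rewrite normr0 sumr_ge0.
apply: le_trans (IHn (n - L)%N _) _; first by lia.
rewrite -!(big_mkord xpredT (fun m => `|((1 - 'X^L) * C)`_m|)).
rewrite [leRHS](@big_cat_nat _ _ _ (n - L).+1) /=; [|lia..].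
by rewrite lerDl sumr_ge0.
Qed.

Lemma coef_div_oneBXn_exp (R : numDomainType) (L d : nat) (K : R) (C : {poly R}) :
  (0 < L)%N ->
  (forall n, \sum_(m < n) `|((1 - 'X^L) ^+ d.+1 * C)`_m| <= K) ->
  forall n, `|C`_n| <= K * n.+1%:R ^+ d.
Proof.
move=> L_gt0; elim: d C => [|d IHd] C boundC n.
  by rewrite mulr1 (le_trans (coef_div_oneBXn _ _ L_gt0)) // -[1 - _]expr1.
apply: le_trans (coef_div_oneBXn _ _ L_gt0) _.
have boundC' := IHd ((1 - 'X^L) * C) ltac:(by move=> m; rewrite mulrA -exprSr).
have K_ge0 : 0 <= K by apply: le_trans (boundC 0%N); rewrite big_ord0.
apply: (@le_trans _ _ (\sum_(m < n.+1) K * n.+1%:R ^+ d)).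
  apply: ler_sum => m _; apply: le_trans (boundC' m) _.
  by rewrite ler_wpM2l // lerXn2r ?nnegrE // ler_nat ltn_ord.
by rewrite sumr_const card_ord exprS -[leLHS]mulr_natr -mulrA [_ * n.+1%:R]mulrC.
Qed.

Lemma l1_mul_oneBXn (R : numDomainType) (w : nat) (K : R) (B : {poly R}) :
  (forall n, \sum_(m < n) `|B`_m| <= K) ->
  forall n, \sum_(m < n) `|((1 - 'X^w) * B)`_m| <= 2 * K.
Proof.
move=> boundB n.
apply: (@le_trans _ _ (\sum_(m < n) (`|B`_m| + `|('X^w * B)`_m|))).
  by apply: ler_sum => m _; rewrite mulrBl mul1r coefB ler_normB.
rewrite big_split /= mulr_natl mulr2n lerD ?boundB //.
rewrite -(big_mkord xpredT (fun m => `|('X^w * B)`_m|)).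
have [le_nw|lt_wn] := leqP n w.
  rewrite big_nat big1 ?(le_trans _ (boundB 0%N)) ?big_ord0 // => m /andP[_ lt_mn].
  by rewrite coefXnM (leq_trans lt_mn le_nw) normr0.
rewrite (@big_cat_nat _ _ _ w) //=; last exact: ltnW.
rewrite big_nat big1 ?add0r => [|m /andP[_ lt_mw]]; last first.
  by rewrite coefXnM lt_mw normr0.
apply: le_trans (boundB (n - w)%N); rewrite -{1}[w]add0n big_addn big_mkord.
by apply: ler_sum => m _; rewrite coefXnM ltnNge leq_addl addnK.
Qed.

(** The bound depends on the number of factors only and not on the exponents w:
    this makes the remainder estimate uniform in a. *)
Lemma l1_mul_prod_oneBXn (R : numDomainType) (B : {poly R}) (I : Type)
    (r : seq I) (w : I -> nat) (n : nat) :
  \sum_(m < n) `|((\prod_(i <- r) (1 - 'X^(w i))) * B)`_m|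
    <= 2 ^+ size r * \sum_(m < size B) `|B`_m|.
Proof.
elim: r n => [|i r IHr] n /=; last first.
  by rewrite big_cons -mulrA exprS -mulrA; apply: l1_mul_oneBXn.
rewrite big_nil !mul1r; have [le_nB|lt_Bn] := leqP n (size B).
  rewrite -!(big_mkord xpredT (fun m => `|B`_m|)).
  by rewrite [leRHS](@big_cat_nat _ _ _ n) //= lerDl sumr_ge0.
rewrite -!(big_mkord xpredT (fun m => `|B`_m|)).
rewrite (@big_cat_nat _ _ _ (size B)) //=; last exact: ltnW.
rewrite [X in _ + X]big_nat [X in _ + X]big1 ?addr0 // => m /andP[le_Bm _].
by rewrite nth_default ?normr0.
Qed.

(** The expansion of 1/(1 - X)^(d+1), stated for exact quotients. *)
Lemma coef_div_oneBX_exp (R : comNzRingType) (d : nat) (A : {poly R}) (n : nat) :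
  A`_n = \sum_(m < n.+1) 'C(n - m + d, d)%:R * ((1 - 'X) ^+ d.+1 * A)`_m.
Proof.
elim: d A n => [|d IHd] A n.
  under eq_bigr do rewrite bin0 mul1r expr1.
  elim: n => [|n IHn]; rewrite big_ord_recr /=.
    by rewrite big_ord0 add0r mulrBl mul1r coefB coefXM subr0.
  by rewrite -IHn mulrBl mul1r coefB coefXM addrC subrK.
have expand m : ((1 - 'X) ^+ d.+2 * A)`_m = ((1 - 'X) ^+ d.+1 * ((1 - 'X) * A))`_m.
  by rewrite mulrA -exprSr.
elim: n => [|n IHn].
  have -> : A`_0 = ((1 - 'X) * A)`_0 by rewrite mulrBl mul1r coefB coefXM subr0.
  by rewrite IHd !big_ord_recl !big_ord0 /= subnn !add0n !binn expand.
have step : A`_n.+1 = A`_n + ((1 - 'X) * A)`_n.+1.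
  by rewrite mulrBl mul1r coefB coefXM /= addrC subrK.
rewrite step IHn IHd [in RHS]big_ord_recr [\sum_(_ < n.+2) _]big_ord_recr /=.
rewrite !subnn !add0n !binn expand.
rewrite addrA -big_split /=; congr (_ + _); apply: eq_bigr => m _.
rewrite -expand -mulrDl -natrD subSn -1?ltnS //.
by rewrite (addSn _ d.+1) binS (addSnnS _ d).
Qed.

(** * The numerator as a signed sum over subsets *)

(** An element x of 'I_k stands for the factor of index x + 1. *)
Definition set_weight (k : nat) (S : {set 'I_k}) : nat := \sum_(x in S) x.+1.

Lemma prod_oneBXn_sets (R : comNzRingType) (a k : nat) :
  \prod_(1 <= i < k.+1) (1 - 'X^(a + i)) =
  \sum_(S : {set 'I_k}) (-1) ^+ #|S| *: 'X^(a * #|S| + set_weight S) :> {poly R}.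
Proof.
rewrite big_add1 /= big_mkord.
under [LHS]eq_bigr do rewrite addrC.
rewrite bigA_distr; apply: eq_bigr => S _.
rewrite -big_mkcond /= prodrN -[in RHS]mul_polyC rmorphXn rmorphN1 /= prodrXr.
by rewrite big_split /= sum_nat_const mulnC.
Qed.

Lemma coef_oneBX_exp_sets (R : comNzRingType) (a k d n : nat) (A : {poly R}) :
  (1 - 'X) ^+ d.+1 * A = \prod_(1 <= i < k.+1) (1 - 'X^(a + i)) ->
  A`_n = \sum_(S : {set 'I_k} | (a * #|S| + set_weight S <= n)%N)
    (-1) ^+ #|S| * 'C(n - (a * #|S| + set_weight S) + d, d)%:R.
Proof.
move=> defA; rewrite (coef_div_oneBX_exp d) defA prod_oneBXn_sets.
under eq_bigr do rewrite coef_sum mulr_sumr.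
rewrite exchange_big /= [RHS]big_mkcond; apply: eq_bigr => S _.
under eq_bigr do rewrite coefZ coefXn mulrCA.
case: ifP => [le_wn|/negbT gt_wn].
  rewrite (bigD1 (Ordinal (le_wn : (_ < n.+1)%N))) //= eqxx mulr1 big1 ?addr0 // => m.
  by rewrite -val_eqE /= => /negPf ->; rewrite !mulr0.
rewrite big1 // => m _; case: eqP => [eq_mw|_]; last by rewrite !mulr0.
by case/negP: gt_wn; rewrite -eq_mw -ltnS.
Qed.

(** * Binomial coefficients as polynomials in a *)

Lemma size_prod_linear (R : nzRingType) (r : R) (c : nat -> R) (d : nat) :
  (size (\prod_(i < d) (r *: 'X + (c i)%:P))%R <= d.+1)%N.
Proof.
elim: d => [|d IHd]; first by rewrite big_ord0 size_poly1.
rewrite big_ord_recr /=; apply: leq_trans (size_polyMleq _ _) _.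
have : (size (r *: 'X + (c d)%:P)%R <= 2)%N.
  apply: leq_trans (size_polyD _ _) _; rewrite geq_max.
  rewrite (leq_trans (size_scale_leq _ _)) ?size_polyX //=.
  by apply: leq_trans (size_polyC_leq1 _) _.
move=> size_factor; rewrite -subn1 leq_subLR.
by apply: leq_trans (leq_add IHd size_factor) _; rewrite addn2.
Qed.

Lemma lead_coef_prod_linear (R : comNzRingType) (r : R) (c : nat -> R) (d : nat) :
  (\prod_(i < d) (r *: 'X + (c i)%:P))`_d = r ^+ d.
Proof.
elim: d => [|d IHd]; first by rewrite big_ord0 coef1.
rewrite big_ord_recr /= mulrDr coefD -scalerAr coefZ coefMX IHd coefMC /=.
by rewrite nth_default ?size_prod_linear // mul0r addr0 exprS.
Qed.

Lemma next_coef_prod_linear (R : comNzRingType) (r : R) (c : nat -> R) (d : nat) :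
  (\prod_(i < d.+1) (r *: 'X + (c i)%:P))`_d = r ^+ d * \sum_(i < d.+1) c i.
Proof.
elim: d => [|d IHd]; rewrite big_ord_recr /= mulrDr coefD -scalerAr coefZ coefMX coefMC /=.
  by rewrite !big_ord0 coef1 big_ord1 mulr0 add0r.
rewrite IHd lead_coef_prod_linear [in RHS]big_ord_recr /= !exprS; ring.
Qed.

(** binom(ra - e + d, d) as a polynomial in a, see [shifted_binomialE]. *)
Definition shifted_binomial (R : fieldType) (r e d : nat) : {poly R} :=
  d`!%:R^-1 *: \prod_(i < d) (r%:R *: 'X + ((d - i)%:R - e%:R)%:P).

Lemma shifted_binomialE (R : numFieldType) (r e d a : nat) : (e <= r * a)%N ->
  (shifted_binomial R r e d).[a%:R] = 'C(r * a - e + d, d)%:R.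
Proof.
move=> le_e; apply: (mulIf (_ : d`!%:R != 0)); first by rewrite pnatr_eq0 -lt0n fact_gt0.
rewrite -natrM bin_ffact hornerZ mulrC mulrA mulfV ?mul1r; last first.
  by rewrite pnatr_eq0 -lt0n fact_gt0.
rewrite ffact_prod natr_prod horner_prod; apply: eq_bigr => i _.
rewrite hornerD hornerZ hornerX hornerC -addnBA 1?ltnW // natrD (natrB _ le_e) natrM.
by ring.
Qed.

Lemma size_shifted_binomial (R : fieldType) (r e d : nat) :
  (size (shifted_binomial R r e d) <= d.+1)%N.
Proof.
exact: leq_trans (size_scale_leq _ _) (size_prod_linear _ (fun i => (d - i)%:R - e%:R) d).
Qed.

Lemma lead_coef_shifted_binomial (R : fieldType) (r e d : nat) :
  (shifted_binomial R r e d)`_d = r%:R ^+ d / d`!%:R.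
Proof.
by rewrite coefZ (lead_coef_prod_linear _ (fun i => (d - i)%:R - e%:R)) mulrC.
Qed.

Lemma next_coef_shifted_binomial (R : numFieldType) (r e d : nat) :
  (shifted_binomial R r e d.+1)`_d = r%:R ^+ d * (d.+2%:R / 2%:R - e%:R) / d`!%:R.
Proof.
rewrite coefZ (next_coef_prod_linear _ (fun i => (d.+1 - i)%:R - e%:R)).
have -> : \sum_(i < d.+1) ((d.+1 - i)%:R - e%:R) = d.+1%:R * (d.+2%:R / 2%:R - e%:R) :> R.
  rewrite sumrB sumr_const card_ord -[e%:R *+ _]mulr_natl mulrBr; congr (_ - _).
  elim: d => [|d IHd]; first by rewrite big_ord1 subn0; field.
  rewrite big_ord_recl /=; under eq_bigr do rewrite subSS.
  by rewrite IHd subn0 -![d.+3%:R]natr1 -![d.+2%:R]natr1; field.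
by rewrite factS natrM; field; rewrite !(pnatr_eq0, nat1r, natr1) -?lt0n ?fact_gt0.
Qed.

(** The shape is that of the main part: the coefficient of degree m + 2 cancels
    and the one of degree m + 1 is the leading term. *)
Lemma horner_top_coefs (R : numDomainType) (p : {poly R}) (m : nat) :
  (size p <= m.+3)%N -> p`_m.+2 = 0 ->
  exists K, forall a, (0 < a)%N ->
    `|p.[a%:R] - p`_m.+1 * a%:R ^+ m.+1| <= K * a%:R ^+ m.
Proof.
move=> size_p p_m2; exists (\sum_(i < m.+1) `|p`_i|) => a a_gt0.
rewrite (horner_coef_wide _ size_p) big_ord_recr big_ord_recr /= p_m2 mul0r addr0 addrK.
rewrite mulr_suml.
apply: le_trans (ler_norm_sum _ _ _) _; apply: ler_sum => i _.
rewrite normrM normrX normr_nat ler_wpM2l // ler_weXn2l ?ler1n //.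
by rewrite -ltnS.
Qed.

(** * The main part *)

(** The values at a of the coefficient of q^(aj-c) in
    N (u0/(1-q)^(k-1) + u1/(1-q)^(k-2)), restricted to the subsets S that
    contribute for large a. *)
Definition main_poly (R : numFieldType) (c j : nat) : {poly R} :=
  let k := (2 * j)%N in
  \sum_(S : {set 'I_k} | (#|S| < j)%N) (-1) ^+ #|S| *:
    (k`!%:R^-1 *: shifted_binomial R (j - #|S|) (c + set_weight S) (k - 2)
     + ((k * k.-1)%:R / 4%:R / k`!%:R)
         *: shifted_binomial R (j - #|S|) (c + set_weight S) (k - 3)).

Lemma size_main_poly (R : numFieldType) (c j : nat) : (3 <= j)%N ->
  (size (main_poly R c j) <= (2 * j - 4).+3)%N.
Proof.
move=> le3j; apply: leq_trans (size_sum _ _ _) _; apply/bigmax_leqP => S _.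
apply: leq_trans (size_scale_leq _ _) _; apply: leq_trans (size_polyD _ _) _.
rewrite geq_max; apply/andP; split; apply: leq_trans (size_scale_leq _ _) _;
  apply: leq_trans (size_shifted_binomial _ _ _ _) _; lia.
Qed.

(** Only the binomials of degree k - 2 contribute, through (j - |S|)^(k-2). *)
Lemma coef_main_poly_top (R : numFieldType) (c j : nat) : (3 <= j)%N ->
  (main_poly R c j)`_((2 * j - 4).+2) = 0.
Proof.
move=> le3j; rewrite /main_poly /= coef_sum.
rewrite (_ : (2 * j - 4).+2 = 2 * j - 2)%N; last by lia.
pose F i : R := (-1) ^+ i * (j - i)%:R ^+ (2 * j - 2) / ((2 * j)`!%:R * (2 * j - 2)`!%:R).
rewrite (eq_bigr (fun S : {set 'I_(2 * j)} => F #|S|)) => [|S _]; last first.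
  rewrite coefZ coefD [X in _ * (_ + X)]coefZ [X in _ * (X + _)]coefZ lead_coef_shifted_binomial.
  rewrite [X in _ + _ * X]nth_default; last first.
    by apply: leq_trans (size_shifted_binomial _ _ _ _) _; lia.
  by rewrite mulr0 addr0 /F invfM; ring.
have half0 := @half_alternating_binomial_sum R j ltac:(lia).
rewrite big_sets_by_card -[RHS](mulr0 ((2 * j)`!%:R * (2 * j - 2)`!%:R)^-1) -[X in _ = _ * X]half0.
rewrite mulr_sumr; apply: eq_bigr => i _; rewrite (eq_bigr (fun=> F i * 1%N%:R)) => [|S /eqP->].
  by rewrite -mulr_sumr -natr_sum card_sets_by_card /F; ring.
by rewrite mulr1.
Qed.

Lemma coef_main_poly (R : numFieldType) (c j : nat) : (3 <= j)%N ->
  (main_poly R c j)`_((2 * j - 4).+1) =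
  (2 * c + 1)%:R / ((2 * j - 3)`!%:R * (2 * j)`!%:R) * Dk R (2 * j).
Proof.
move=> le3j; rewrite /main_poly /= coef_sum.
rewrite (_ : 2 * j - 2 = (2 * j - 3).+1)%N; last by lia.
rewrite (_ : (2 * j - 4).+1 = 2 * j - 3)%N; last by lia.
have k0 : (2 * j)`!%:R != 0 :> R by rewrite pnatr_eq0 -lt0n fact_gt0.
have d0 : (2 * j - 3)`!%:R != 0 :> R by rewrite pnatr_eq0 -lt0n fact_gt0.
pose N : R := (2 * j)`!%:R * (2 * j - 3)`!%:R.
have N0 : N != 0 by rewrite mulf_neq0.
(* b collects what does not depend on S, once e = c + s(S) has been split. *)
pose b : R := (2 * j - 1)%:R / 2%:R - c%:R + (2 * j * (2 * j).-1)%:R / 4%:R.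
pose F i : R := (-1) ^+ i * (j - i)%:R ^+ (2 * j - 3) / N.
rewrite (eq_bigr (fun S : {set 'I_(2 * j)} =>
    F #|S| * b * 1%N%:R - F #|S| * (set_weight S)%:R)) => [|S _]; last first.
  rewrite coefZ coefD [X in _ * (_ + X)]coefZ [X in _ * (X + _)]coefZ.
  rewrite lead_coef_shifted_binomial next_coef_shifted_binomial.
  rewrite (_ : (2 * j - 3).+2 = 2 * j - 1)%N; last by lia.
  by rewrite natrD /F /N /b; field; rewrite k0 d0.
(* b - i(k+1)/2 = -(2c+1)/2 + (j - i)(k+1)/2 separates the powers k - 3 and k - 2 of j - i. *)
rewrite big_sets_by_card.
pose f n (i : 'I_j) : R := (-1) ^+ i * 'C(2 * j, i)%:R * (j - i)%:R ^+ n.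
rewrite (eq_bigr (fun i : 'I_j => - (2 * c + 1)%:R / 2%:R / N * f (2 * j - 3)%N i
    + (2 * j).+1%:R / 2%:R / N * f (2 * j - 2)%N i)) => [|i _]; last first.
  rewrite (eq_bigr (fun S : {set 'I_(2 * j)} => F i * b * 1%N%:R - F i * (set_weight S)%:R));
    last by move=> S /eqP->.
  rewrite sumrB -!mulr_sumr -!natr_sum card_sets_by_card.
  have -> : (\sum_(S : {set 'I_(2 * j)} | #|S| == i) set_weight S)%:R =
      'C(2 * j, i)%:R * (i%:R * (2 * j).+1%:R) / 2%:R :> R.
    apply: (mulIf (_ : 2%:R != 0)); first by rewrite pnatr_eq0.
    by rewrite mulfVK ?pnatr_eq0 // -!natrM mulnC set_sum_by_card.
  rewrite /f /F (_ : 2 * j - 2 = (2 * j - 3).+1)%N; last by lia.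
  rewrite exprS /b natrB; last by apply: ltnW.
  rewrite subn1 -![(2 * j).+1%:R]natr1 !natrM (_ : (2 * j).-1%:R = 2%:R * j%:R - 1 :> R).
    by rewrite natrD natrM; field.
  by rewrite -subn1 natrB ?natrM //; lia.
rewrite big_split /= -!mulr_sumr half_alternating_binomial_sum ?mulr0 ?addr0; last by lia.
have -> : Dk R (2 * j) = - 2%:R^-1 * \sum_(i < j) f (2 * j - 3)%N i.
  rewrite /Dk mul2n doubleK big_mkord mulNr -mulrN -sumrN; congr (_ * _).
  by apply: eq_bigr => i _; rewrite exprS /f mul2n; ring.
by rewrite /N; field; rewrite k0 d0.
Qed.

(** * The remainder and the asymptotic estimate *)

Lemma set_weight_le (k : nat) (S : {set 'I_k}) : (set_weight S <= k * k)%N.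
Proof.
apply: leq_trans (_ : \sum_(x in S) k <= _)%N; first by apply: leq_sum => x _; apply: ltn_ord.
by rewrite sum_nat_const leq_mul2r -[X in (_ <= X)%N](card_ord k) max_card orbT.
Qed.

Lemma set_weight_gt0 (k : nat) (S : {set 'I_k}) : (0 < #|S|)%N -> (0 < set_weight S)%N.
Proof. by case/card_gt0P => x xS; rewrite /set_weight (bigD1 x). Qed.

(** The exponent a|S| + s(S) of the term of S stays below aj - c exactly when
    |S| < j: for |S| < j there is room a to absorb c and s(S), and for |S| = j
    the positivity of s(S) excludes S even if c = 0. *)
Lemma small_setsP (a c j : nat) (S : {set 'I_(2 * j)}) :
  (0 < j)%N -> (c + (2 * j) * (2 * j) <= a)%N ->
  (a * #|S| + set_weight S <= a * j - c)%N = (#|S| < j)%N.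
Proof.
move=> j_gt0 le_a; have le_w := set_weight_le S.
have [ltSj|leSj] := ltnP #|S| j.
  have : (a * #|S| + a <= a * j)%N by rewrite addnC -mulnS leq_mul2l ltSj orbT.
  by lia.
have w_gt0 : (0 < set_weight S)%N by apply: set_weight_gt0; apply: leq_trans leSj.
have : (a * j <= a * #|S|)%N by rewrite leq_mul2l leSj orbT.
by lia.
Qed.

Lemma main_poly_spec (R : numFieldType) (a c j : nat) (A B : {poly R}) :
  let k := (2 * j)%N in
  (3 <= j)%N -> (c + k * k <= a)%N ->
  (1 - 'X) ^+ (k - 1) * A = \prod_(1 <= i < k.+1) (1 - 'X^(a + i)) ->
  (1 - 'X) ^+ (k - 2) * B = \prod_(1 <= i < k.+1) (1 - 'X^(a + i)) ->
  k`!%:R^-1 * A`_(a * j - c) + ((k * k.-1)%:R / 4%:R / k`!%:R) * B`_(a * j - c)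
  = (main_poly R c j).[a%:R].
Proof.
move=> k le3j le_a defA defB.
have {}defA : (1 - 'X) ^+ (k - 2).+1 * A = \prod_(1 <= i < k.+1) (1 - 'X^(a + i)).
  by rewrite -defA; congr (_ ^+ _ * _); rewrite /k; lia.
have {}defB : (1 - 'X) ^+ (k - 3).+1 * B = \prod_(1 <= i < k.+1) (1 - 'X^(a + i)).
  by rewrite -defB; congr (_ ^+ _ * _); rewrite /k; lia.
rewrite (coef_oneBX_exp_sets _ defA) (coef_oneBX_exp_sets _ defB).
have small S := @small_setsP a c j S ltac:(lia) le_a.
rewrite !(eq_bigl _ _ small) !mulr_sumr -big_split /= /main_poly horner_sum.
apply: eq_bigr => S ltSj.
have room : (c + set_weight S <= (j - #|S|) * a)%N.
  apply: leq_trans (_ : 1 * a <= _)%N; last by rewrite leq_mul2r subn_gt0 ltSj orbT.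
  by rewrite mul1n; apply: leq_trans le_a; rewrite leq_add2l set_weight_le.
rewrite hornerZ hornerD [X in _ = _ * (X + _)]hornerZ [X in _ = _ * (_ + X)]hornerZ.
rewrite !shifted_binomialE //.
have -> : (a * j - c - (a * #|S| + set_weight S) = (j - #|S|) * a - (c + set_weight S))%N.
  by rewrite mulnBl ![(_ * a)%N]mulnC; lia.
by rewrite -/k; ring.
Qed.

Lemma oneBX_qbinom (F : fieldType) (a k : nat) : (1 <= k)%N ->
  (1 - 'X) ^+ (k - 1) * qfact F k * ((1 - 'X) * qbinom F a k) =
  \prod_(1 <= i < k.+1) (1 - 'X^(a + i)).
Proof.
move=> k_gt0; rewrite -qbinomE -mul_qfact //.
have -> : (1 - 'X) ^+ k = (1 - 'X) ^+ (k - 1) * (1 - 'X) :> {poly F}.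
  by rewrite -exprSr subn1 prednK.
ring.
Qed.

(** (1-q)^2 h G = h N / ((1-q)^(k-3) Q), rewritten over the denominator
    (1 - q^L)^(k-3) with L = k!. *)
Lemma qbinom_remainder_bound (R : numFieldType) (k : nat) (h : {poly R}) : (5 <= k)%N ->
  exists K, forall a n,
    `|((1 - 'X) ^+ 2 * h * ((1 - 'X) * qbinom R a k))`_n| <= K * n.+1%:R ^+ (k - 4).
Proof.
move=> le5k.
have dvd_fact i : (0 < i <= k)%N -> (i %| k`!)%N.
  by move=> /andP[i_gt0 le_ik]; apply: dvdn_fact; rewrite i_gt0.
have /dvdpP[M defM] := qfact_dvd R le5k dvd_fact.
exists (2 ^+ size (index_iota 1 k.+1) * \sum_(m < size (M * h)) `|(M * h)`_m|) => a n.
apply: (coef_div_oneBXn_exp (fact_gt0 k)) => {}n.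
rewrite (_ : (k - 4).+1 = k - 3)%N; last by lia.
rewrite defM.
set G := (1 - 'X) * qbinom R a k.
have -> : M * ((1 - 'X) ^+ (k - 3) * qfact R k) * ((1 - 'X) ^+ 2 * h * G) =
    (\prod_(1 <= i < k.+1) (1 - 'X^(a + i))) * (M * h).
  rewrite -oneBX_qbinom; last by lia.
  by rewrite (_ : (k - 1 = k - 3 + 2)%N) ?exprD -/G; [ring | lia].
exact: l1_mul_prod_oneBXn.
Qed.

Lemma qbinom_difference_bound (R : numFieldType) (c j : nat) :
  let k := (2 * j)%N in (3 <= j)%N ->
  exists K, forall a, (c + k * k <= a)%N ->
    `|((1 - 'X) * qbinom R a k)`_(a * j - c)
      - (2 * c + 1)%:R / ((k - 3)`!%:R * k`!%:R) * Dk R k * a%:R ^+ (k - 3)|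
    <= K * a%:R ^+ (k - 4).
Proof.
move=> k le3j.
have le6k : (6 <= k)%N by rewrite /k; lia.
have [h inv_k] := @qfact_inverse R k ltac:(lia).
have [K1 bound1] := qbinom_remainder_bound h (ltnW le6k).
have [K2 bound2] := horner_top_coefs (size_main_poly R c le3j) (coef_main_poly_top R c le3j).
exists (K1 * j.+1%:R ^+ (k - 4) + K2) => a le_a.
have a_gt0 : (0 < a)%N by nia.
set G := (1 - 'X) * qbinom R a k; set n := (a * j - c)%N.
have defG := @oneBX_qbinom R a k ltac:(lia).
rewrite -/G in defG.
have splitG : G`_n = (main_poly R c j).[a%:R] + ((1 - 'X) ^+ 2 * h * G)`_n.
  rewrite -[in LHS](mul1r G) -[in LHS]inv_k mulrDl coefD; congr (_ + _).
  rewrite -(@main_poly_spec R a c j (qfact R k * G) ((1 - 'X) * (qfact R k * G))) //.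
  - rewrite -!coefCM -coefD; apply: (congr1 (fun p : {poly R} => p`_n)); rewrite -/k; ring.
  - by rewrite mulrA.
  - by rewrite mulrA -exprSr mulrA -defG (_ : (2 * j - 2).+1 = k - 1)%N //; rewrite /k; lia.
rewrite splitG addrAC mulrDl addrC; apply: le_trans (ler_normD _ _) _; apply: lerD; last first.
  have := bound2 a a_gt0; rewrite coef_main_poly //.
  by rewrite (_ : (2 * j - 4).+1 = k - 3)%N; last by rewrite /k; lia.
apply: le_trans (bound1 a n) _.
have K1_ge0 : 0 <= K1.
  by apply: le_trans (normr_ge0 _) (le_trans (bound1 a 0%N) _); rewrite expr1n mulr1.
rewrite -mulrA -exprMn -natrM ler_wpM2l // lerXn2r ?nnegrE // ler_nat.
by rewrite /n mulSn mulnC; lia.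
Qed.

(** At n = 0 the exponent n - 1 is negative and contributes 0, as it does for the
    coefficients of X p. *)
Lemma coefz_difference (R : nzRingType) (n : nat) (p : {poly R}) :
  coefz n%:Z p - coefz (n%:Z - 1) p = ((1 - 'X) * p)`_n.
Proof.
rewrite mulrBl mul1r coefB coefXM; case: n => [|n] //.
by rewrite (_ : n.+1%:Z - 1 = n%:Z) //; lia.
Qed.

Theorem theorem2p6 (R : realType) (c j k : nat) (hk : k = (2 * j)%N)
    (hj : (3 <= j)%N) :
  (fun a : nat => coefz (a%:Z * j%:Z - c%:Z) (qbinom R a k)
                - coefz (a%:Z * j%:Z - c%:Z - 1) (qbinom R a k))
  = (fun a : nat => (2 * c + 1)%:R / ((k - 3)`!%:R * k`!%:R) * Dk R k
                    * a%:R ^+ (k - 3))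
    +O_\oo (fun a : nat => a%:R ^+ (k - 4) : R).
Proof.
rewrite {k}hk; have [K boundK] := qbinom_difference_bound R c hj.
apply/eqaddOP; near=> K'; near=> a.
have le_a : (c + 2 * j * (2 * j) <= a)%N by near: a; apply: nbhs_infty_ge.
rewrite fctE.
have -> : a%:Z * j%:Z - c%:Z = (a * j - c)%N%:Z.
  by rewrite -PoszM subzn //; nia.
rewrite /= coefz_difference [`|a%:R ^+ _|]ger0_norm ?exprn_ge0 //.
apply: le_trans (boundK a le_a) _; rewrite ler_wpM2r ?exprn_ge0 //.
by near: K'; apply: nbhs_pinfty_ge; rewrite num_real.
Unshelve. all: by end_near.
Qed.
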